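(* Let $k$ be a non-negative integer and $l$ a positive integer, and set \[Q_{k,l}(m,n)=(m+n)l+k\frac{n(n-1)}{2}+(n-1)mk+(k+1)\frac{m(m+1)}{2}.\] Then, as formal power series in $x,q$, \[ \sum_{\pi\in\mathcal{UG}_{k,l}}x^{\#(\pi)}q^{|\pi|}=\sum_{m,n\geq 0}\frac{x^{m+n}q^{Q_{k,l}(m,n)}}{(q;q)_m(q^2;q^2)_{\lfloor n/2\rfloor}} =\sum_{m,n\geq 0}\frac{x^{m+2n}q^{Q_{k,l}(m,2n)}\left(1+xq^{l+(m+2n)k}\right)}{(q;q)_m(q^2;q^2)_{n}}. \]
   Context: A partition is a finite non-decreasing sequence $\pi=(\lambda_1,\lambda_2,\dots,\lambda_{\#(\pi)})$ of positive integers (the empty sequence is the unique partition of $0$); $\#(\pi)$ is its number of parts and $|\pi|=\sum_i\lambda_i$ its norm. $\mathcal{UG}_{k,l}$ is the set of partitions with $\lambda_1\ge l$ and $\lambda_i-\lambda_{i-1}\ge k$ for $2\le i\le\#(\pi)$ (including the empty partition). $(a;q)_j=\prod_{i=0}^{j-1}(1-aq^i)$. *)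

(* Defs.v *)
From HB Require Import structures.
From mathcomp Require Import all_boot all_order all_algebra.
From mathcomp Require Import boolp classical_sets functions cardinality fsbigop.
Set Implicit Arguments.
Unset Strict Implicit.
Unset Printing Implicit Defensive.
Import Order.TTheory GRing.Theory Num.Theory.
Local Open Scope ring_scope.
Local Open Scope classical_set_scope.

(* R[[T]].  A record rather than the bare type nat -> R, because the latter
   already carries the pointwise product. *)
Record fps (R : Type) := Fps { fcoef : nat -> R }.

HB.instance Definition _ (R : Type) := gen_eqMixin (fps R).
HB.instance Definition _ (R : Type) := gen_choiceMixin (fps R).

Lemma fpsP (R : Type) (f g : fps R) : (forall n, fcoef f n = fcoef g n) -> f = g.
Proof. by case: f g => [f] [g] /= /funext ->. Qed.

Section FpsRing.
Variable R : comNzRingType.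
Implicit Types f g h : fps R.

Definition fps_const (c : R) : fps R := Fps (fun n => if n == 0%N then c else 0).
Definition fps_add f g : fps R := Fps (fun n => fcoef f n + fcoef g n).
Definition fps_opp f : fps R := Fps (fun n => - fcoef f n).
Definition fps_mul f g : fps R :=
  Fps (fun n => \sum_(i < n.+1) fcoef f i * fcoef g (n - i)).

Fact fps_addA : associative fps_add.
Proof. by move=> f g h; apply: fpsP => n /=; rewrite addrA. Qed.
Fact fps_addC : commutative fps_add.
Proof. by move=> f g; apply: fpsP => n /=; rewrite addrC. Qed.
Fact fps_add0 : left_id (fps_const 0) fps_add.
Proof. by move=> f; apply: fpsP => n /=; rewrite if_same add0r. Qed.
Fact fps_addN : left_inverse (fps_const 0) fps_opp fps_add.
Proof. by move=> f; apply: fpsP => n /=; rewrite if_same addNr. Qed.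

HB.instance Definition _ := GRing.isZmodule.Build (fps R)
  fps_addA fps_addC fps_add0 fps_addN.

Let trunc N f : {poly R} := \poly_(i < N) fcoef f i.

Let coef_trunc_mul N f g n :
  (n < N)%N -> (trunc N f * trunc N g)`_n = fcoef (fps_mul f g) n.
Proof.
move=> ltnN; rewrite coefM /=; apply: eq_bigr => i _.
have leiN : (i < N)%N by apply: leq_trans ltnN.
by rewrite !coef_poly leiN (leq_ltn_trans (leq_subr _ _) ltnN).
Qed.

Fact fps_mulC : commutative fps_mul.
Proof. by move=> f g; apply: fpsP => n; rewrite -!(@coef_trunc_mul n.+1) // mulrC. Qed.

Fact fps_mulA : associative fps_mul.
Proof.
move=> f g h; apply: fpsP => n.
transitivity (trunc n.+1 f * trunc n.+1 g * trunc n.+1 h)`_n.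
  rewrite -mulrA coefM; apply: eq_bigr => i _.
  by rewrite coef_trunc_mul ?ltnS ?leq_subr // coef_poly ltn_ord.
rewrite coefM; apply: eq_bigr => i _.
by rewrite coef_trunc_mul ?ltn_ord // coef_poly ltnS leq_subr.
Qed.

Fact fps_mul1 : left_id (fps_const 1) fps_mul.
Proof.
move=> f; apply: fpsP => n /=; rewrite big_ord_recl /= mul1r subn0 big1 ?addr0 //.
by move=> i _; rewrite mul0r.
Qed.

Fact fps_mulDl : left_distributive fps_mul fps_add.
Proof.
move=> f g h; apply: fpsP => n /=; rewrite -big_split.
by apply: eq_bigr => i _; rewrite mulrDl.
Qed.

Fact fps_one_neq0 : fps_const 1 != 0.
Proof.
by apply/eqP => /(congr1 (fun f => fcoef f 0%N)) /eqP /=; rewrite oner_eq0.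
Qed.

HB.instance Definition _ := GRing.Zmodule_isComNzRing.Build (fps R)
  fps_mulA fps_mulC fps_mul1 fps_mulDl fps_one_neq0.

Definition fps_unit : pred (fps R) := fun f => `[< exists g, g * f = 1 >].

(* As for any MathComp ring, the inverse of a non-unit is the series itself; a
   series with invertible constant coefficient, such as 1 - q^i for i > 0, is a
   unit. *)
Definition fps_inv f : fps R :=
  if pselect (exists g, g * f = 1) is left fV then projT1 (cid fV) else f.

Fact fps_mulVr : {in fps_unit, left_inverse 1 fps_inv *%R}.
Proof.
move=> f; rewrite unfold_in /fps_inv => /asboolP fU.
by case: pselect => // fV; case: (cid fV).
Qed.

Fact fps_unitP f g : g * f = 1 -> fps_unit f.
Proof. by move=> gf1; apply/asboolP; exists g. Qed.

Fact fps_inv_out : {in [predC fps_unit], fps_inv =1 id}.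
Proof.
move=> f; rewrite inE /= unfold_in /fps_inv => /asboolP fNU.
by case: pselect.
Qed.

HB.instance Definition _ := GRing.ComNzRing_hasMulInverse.Build (fps R)
  fps_mulVr fps_unitP fps_inv_out.

Definition fps_var : fps R := Fps (fun n => (n == 1%N)%:R).

End FpsRing.

(* Z[[x,q]], as (Z[[q]])[[x]]: the coefficient of x^a q^b in f is
   fcoef (fcoef f a) b. *)
Notation series := (fps (fps int)).

Definition xvar : series := fps_var (fps int).
Definition qvar : series := fps_const (fps_var int).

Definition series_coef (f : series) (a b : nat) : int := fcoef (fcoef f a) b.

Definition summable (I : choiceType) (D : set I) (F : I -> series) : Prop :=
  forall a b, finite_set (D `&` [set i | series_coef (F i) a b != 0]).

(* The finitely supported sum is 0 by convention on an infinite support, so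
   this is the sum of the family only when the family is summable. *)
Definition formal_sum (I : choiceType) (D : set I) (F : I -> series) : series :=
  Fps (fun a => Fps (fun b => \sum_(i \in D) series_coef (F i) a b)).

Definition qpoch (R : comNzRingType) (a q : R) (j : nat) : R :=
  \prod_(i < j) (1 - a * q ^+ i).

Definition is_partition (s : seq nat) : bool := sorted leq s && all (leq 1) s.

(* Parts are indexed from 0; the empty sequence satisfies all conditions. *)
Definition UG (k l : nat) : set (seq nat) :=
  [set s | is_partition s
         /\ ((0 < size s)%N -> (l <= nth 0 s 0)%N)
         /\ (forall i, (i.+1 < size s)%N -> (nth 0 s i + k <= nth 0 s i.+1)%N)].

(* Integer-valued because of the factor n - 1 at n = 0; both divisions by 2
   are exact. *)
Definition Qexp (k l m n : nat) : int :=
  (m%:Z + n%:Z) * l%:Z + k%:Z * ((n%:Z * (n%:Z - 1)) %/ 2)%Z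
  + (n%:Z - 1) * m%:Z * k%:Z + (k%:Z + 1) * ((m%:Z * (m%:Z + 1)) %/ 2)%Z.

(* Hence q ^ Qexp k l m n is a genuine power of q, although q is not
   invertible. *)
Lemma Qexp_ge0 (k l m n : nat) : 0 <= Qexp k l m n.
Proof.
have half2 (i : nat) : ((i%:Z * (i%:Z + 1)) %/ 2)%Z = 'C(i.+1, 2)%:Z.
  by rewrite bin2 -PoszD -PoszM addn1 mulnC -divn2 divz_nat.
rewrite /Qexp half2.
case: n => [|n]; last first.
  have -> : n.+1%:Z - 1 = n%:Z by rewrite -addn1 PoszD addrK.
  have -> : n.+1%:Z = n%:Z + 1 by rewrite -addn1 PoszD.
  by rewrite [X in (X %/ 2)%Z]mulrC half2.
rewrite mul0r div0z mulr0 !addr0 sub0r mulN1r mulNr.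
have mC : m%:Z <= 'C(m.+1, 2)%:Z by rewrite lez_nat binS bin1 leq_addl.
rewrite mulrDl mul1r -addrA addr_ge0 // addrA addr_ge0 //.
by rewrite addrC subr_ge0 mulrC ler_wpM2l.
Qed.

(* Main.v *)
(* Since Q_{k,l}(m,n) = N l + k N(N-1)/2 + m(m+1)/2 with N = m + n, comparing
   the coefficients of x^N reduces the first equality to two facts.

   - The partitions in UG_{k,l} with N parts have generating function
     q^(N l + k N(N-1)/2) / (q;q)_N.  Removing the smallest part h leaves a
     member of UG_{k,h+k}; separating h = l from h > l gives
     P_{N+1}(l) = q^l P_N(l+k) + P_{N+1}(l+1), which the closed form also
     satisfies, and the difference of two solutions is independent of l while
     divisible by q^l, hence zero.

   - sum_{m+n=N} q^(m(m+1)/2) / ((q;q)_m (q^2;q^2)_{floor(n/2)}) = 1/(q;q)_N,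
     the coefficient of z^N in (-zq;q)_oo (1+z)/(z^2;q^2)_oo = 1/(z;q)_oo.
     The product is handled through the effect of the dilation z -> qz on each
     factor, which avoids infinite products.

   The second equality pairs the terms n = 2j and n = 2j+1 of the double sum. *)
Require Import Defs.
From HB Require Import structures.
From mathcomp Require Import all_boot all_order all_algebra.
From mathcomp Require Import boolp classical_sets functions cardinality fsbigop.
From mathcomp Require Import ring zify.
Import Order.TTheory GRing.Theory Num.Theory.
Set Implicit Arguments.
Unset Strict Implicit.
Unset Printing Implicit Defensive.
Local Open Scope ring_scope.
Local Open Scope classical_set_scope.

(** * Coefficients, units and dilation of power series *)

Section FpsCoefficients.
Variable R : comNzRingType.
Implicit Types f g : fps R.

Lemma fcoefM f g n :
  fcoef (f * g) n = \sum_(i < n.+1) fcoef f i * fcoef g (n - i).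
Proof. by []. Qed.

Lemma fcoef_constM c f n : fcoef (fps_const c * f) n = c * fcoef f n.
Proof.
rewrite fcoefM big_ord_recl /= subn0 big1 ?addr0 // => i _.
by rewrite mul0r.
Qed.

Lemma fcoef_varM f n :
  fcoef (fps_var R * f) n = if n is n'.+1 then fcoef f n' else 0.
Proof.
rewrite fcoefM big_ord_recl /= mul0r add0r.
case: n => [|n]; first by rewrite big_ord0.
rewrite big_ord_recl /= mul1r subSS subn0 big1 ?addr0 // => i _.
by rewrite mul0r.
Qed.

Lemma fcoef_varXM N f n :
  fcoef (fps_var R ^+ N * f) n = if (n < N)%N then 0 else fcoef f (n - N).
Proof.
elim: N n => [|N IHN] n; first by rewrite expr0 mul1r subn0.
by rewrite exprS -mulrA fcoef_varM; case: n => [|n] //; rewrite IHN subSS.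
Qed.

Lemma fcoef_sum (I : Type) (r : seq I) (P : pred I) (F : I -> fps R) n :
  fcoef (\sum_(i <- r | P i) F i) n = \sum_(i <- r | P i) fcoef (F i) n.
Proof.
by apply: (big_morph (fun f => fcoef f n)) => //; apply: if_same.
Qed.

Lemma fps_const_is_zmod_morphism : zmod_morphism (@fps_const R).
Proof.
by move=> c d; apply: fpsP => n /=; case: ifP => // _; rewrite subr0.
Qed.

Lemma fps_const_is_monoid_morphism : monoid_morphism (@fps_const R).
Proof.
split=> // c d; apply: fpsP => n; rewrite fcoef_constM /=.
by case: ifP => // _; rewrite mulr0.
Qed.

HB.instance Definition _ := GRing.isZmodMorphism.Build R (fps R)
  (@fps_const R) fps_const_is_zmod_morphism.
HB.instance Definition _ := GRing.isMonoidMorphism.Build R (fps R)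
  (@fps_const R) fps_const_is_monoid_morphism.

Lemma unit_one_sub_varX N : (0 < N)%N -> 1 - fps_var R ^+ N \is a GRing.unit.
Proof.
(* The inverse is the geometric series in q^N, with coefficient 1 exactly at the multiples of N. *)
move=> N_gt0; pose g := Fps (fun n => (N %| n)%:R : R).
suff gV : (1 - fps_var R ^+ N) * g = 1.
  by apply/unitrPr; exists g.
apply: fpsP => n; rewrite mulrBl mul1r.
have -> : fcoef (g - fps_var R ^+ N * g) n
          = fcoef g n - fcoef (fps_var R ^+ N * g) n by [].
rewrite fcoef_varXM /=; case: ltnP => [n_lt_N|N_le_n].
  rewrite subr0; case: n n_lt_N => [|n] n_lt_N; first by rewrite dvdn0.
  by rewrite gtnNdvd.
rewrite dvdn_subl // subrr.
by case: n N_le_n => // N_le0; move: N_gt0; rewrite ltnNge N_le0.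
Qed.

(** The substitution z -> qz. *)
Definition fps_dilate (q : R) f : fps R := Fps (fun n => q ^+ n * fcoef f n).

Lemma fps_dilateM q f g :
  fps_dilate q (f * g) = fps_dilate q f * fps_dilate q g.
Proof.
apply: fpsP => n; rewrite fcoefM /= mulr_sumr; apply: eq_bigr => i _ /=.
by rewrite mulrACA -exprD subnKC // -ltnS.
Qed.

End FpsCoefficients.

Lemma rmorph_qpoch (R S : comNzRingType) (f : {rmorphism R -> S}) a q j :
  f (qpoch a q j) = qpoch (f a) (f q) j.
Proof.
rewrite /qpoch rmorph_prod; apply: eq_bigr => i _.
by rewrite rmorphB rmorph1 rmorphM rmorphXn.
Qed.

Lemma qpochS (R : comNzRingType) (a q : R) j :
  qpoch a q j.+1 = qpoch a q j * (1 - a * q ^+ j).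
Proof. by rewrite /qpoch big_ord_recr. Qed.

(** * The finite identity for 1/(q;q)_N *)

Section FiniteIdentity.
Variables (R : comUnitRingType) (q : R).
Hypothesis unit_one_sub : forall i, (0 < i)%N -> 1 - q ^+ i \is a GRing.unit.

Lemma unit_qpoch j : qpoch q q j \is a GRing.unit.
Proof. by apply: rpred_prod => i _; rewrite -exprS unit_one_sub. Qed.

Lemma unit_qpoch_sq j : qpoch (q ^+ 2) (q ^+ 2) j \is a GRing.unit.
Proof. by apply: rpred_prod => i _; rewrite -exprS -exprM unit_one_sub. Qed.

(* (-z q; q)_oo *)
Let A : fps R := Fps (fun m => q ^+ 'C(m.+1, 2) / qpoch q q m).
(* 1 / (z^2; q^2)_oo *)
Let C : fps R :=
  Fps (fun n => if odd n then 0 else (qpoch (q ^+ 2) (q ^+ 2) n./2)^-1).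
(* (1 + z) / (z^2; q^2)_oo *)
Let B : fps R := Fps (fun n => (qpoch (q ^+ 2) (q ^+ 2) n./2)^-1).

Let z := fps_var R.
Let s := fps_dilate q.

(** Dilation removes the first factor 1 + qz of the product. On coefficients this reads (1 -
    q^(n+1)) A_(n+1) = q^(n+1) A_n. *)
Let A_dilate : A = (1 + fps_const q * z) * s A.
Proof.
apply: fpsP => n; rewrite mulrDl mul1r -mulrA.
have -> : fcoef (s A + fps_const q * (z * s A)) n
          = q ^+ n * fcoef A n + fcoef (fps_const q * (z * s A)) n by [].
rewrite fcoef_constM fcoef_varM; case: n => [|n].
  by rewrite expr0 mul1r mulr0 addr0.
rewrite /= qpochS -exprS; set u := qpoch q q n.
have uU : u \is a GRing.unit by apply: unit_qpoch.
have vU : 1 - q ^+ n.+1 \is a GRing.unit by apply: unit_one_sub.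
have -> : u^-1 = (1 - q ^+ n.+1) / (u * (1 - q ^+ n.+1)).
  by rewrite invrM // mulVKr.
rewrite binS bin1 exprD !exprS; ring.
Qed.

(** Dilation removes the factor 1 - z^2 from the denominator. On coefficients: q^(n+2) C_(n+2) =
    C_(n+2) - C_n. *)
Let C_dilate : s C = (1 - z ^+ 2) * C.
Proof.
apply: fpsP => n; rewrite mulrBl mul1r.
have -> : fcoef (C - z ^+ 2 * C) n = fcoef C n - fcoef (z ^+ 2 * C) n by [].
rewrite fcoef_varXM; case: n => [|[|n]] /=.
- by rewrite expr0 mul1r subr0.
- by rewrite mulr0 subr0.
rewrite subn2 /= negbK; case: ifP => [_|even_n]; first by rewrite mulr0 subr0.
rewrite qpochS -exprS; set u := qpoch _ _ _; set v := 1 - _.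
have uU : u \is a GRing.unit by apply: unit_qpoch_sq.
have vU : v \is a GRing.unit by rewrite /v -exprM unit_one_sub.
have -> : q ^+ n.+2 = 1 - v.
  (* The new factor v is 1 - (q^2)^(n/2+1), which equals 1 - q^(n+2) because n is even. *)
  by rewrite /v -exprM subKr mulnS mul2n even_halfK ?even_n.
have -> : u^-1 = v / (u * v) by rewrite invrM // mulVKr.
ring.
Qed.

Let B_factor : B = (1 + z) * C.
Proof.
apply: fpsP => n; rewrite mulrDl mul1r.
have -> : fcoef (C + z * C) n = fcoef C n + fcoef (z * C) n by [].
rewrite fcoef_varM; case: n => [|n] /=; first by rewrite addr0.
rewrite uphalf_half; case: (odd n); rewrite ?addr0 ?add0r //.
Qed.

Lemma sum_qpoch_half N :
  \sum_(m < N.+1) q ^+ 'C(m.+1, 2) /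
     (qpoch q q m * qpoch (q ^+ 2) (q ^+ 2) (N - m)./2) = (qpoch q q N)^-1.
Proof.
(* The factor 1 + qz of s(1 + z) turns s(A) back into A, and 1 - z^2 = (1 - z)(1 + z) restores B. *)
have AB_dilate : s (A * B) = (1 - z) * (A * B).
  rewrite /s B_factor 2!fps_dilateM -/s C_dilate {2}A_dilate.
  have -> : s (1 + z) = 1 + fps_const q * z.
    apply: fpsP => n.
    have -> : fcoef (1 + fps_const q * z) n
              = fcoef 1 n + fcoef (fps_const q * z) n by [].
    rewrite fcoef_constM /=.
    by case: n => [|[|n]] /=;
      rewrite ?expr0 ?expr1 !(mulr0, mulr1, addr0, add0r).
  ring.
have -> : \sum_(m < N.+1) q ^+ 'C(m.+1, 2) /
     (qpoch q q m * qpoch (q ^+ 2) (q ^+ 2) (N - m)./2) = fcoef (A * B) N.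
  rewrite fcoefM; apply: eq_bigr => m _ /=.
  by rewrite invrM ?unit_qpoch ?unit_qpoch_sq // mulrAC mulrA.
elim: N => [|N IHN].
  by rewrite fcoefM big_ord1 /= /qpoch !big_ord0 expr0 invr1 !mulr1.
(* The coefficient of z^(N+1) yields (1 - q^(N+1)) S = 1/(q;q)_N. *)
have := congr1 (fun f => fcoef f N.+1) AB_dilate; rewrite mulrBl mul1r.
have -> : fcoef (A * B - z * (A * B)) N.+1
          = fcoef (A * B) N.+1 - fcoef (z * (A * B)) N.+1 by [].
rewrite fcoef_varM IHN.
have -> : fcoef (s (A * B)) N.+1 = q ^+ N.+1 * fcoef (A * B) N.+1 by [].
move: (fcoef (A * B) N.+1) => S.
move=> eqS; apply: (mulIr (unit_qpoch N.+1)); rewrite mulVr ?unit_qpoch //.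
have -> : S * qpoch q q N.+1 = (S - q ^+ N.+1 * S) * qpoch q q N.
  by rewrite qpochS -exprS; ring.
by rewrite eqS opprB addrCA subrr addr0 mulVr ?unit_qpoch.
Qed.

End FiniteIdentity.

(** * Enumeration of partitions by smallest part *)

Section Enumeration.
Variable k : nat.

(** An explicit duplicate-free list, so that a coefficient of the partition series becomes a list
    size. The [iota] runs over l <= h <= b, hence b - h is never truncated. *)
Fixpoint gap_seqs (a l b : nat) : seq (seq nat) :=
  if a is a'.+1 then
    [seq h :: t | h <- iota l (b.+1 - l), t <- gap_seqs a' (h + k) (b - h)]
  else nseq (b == 0%N) [::].

Lemma UG_cons l h t : (0 < l)%N ->
  UG k l (h :: t) <-> (l <= h)%N /\ UG k (h + k) t.
Proof.
move=> l_gt0; split.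
  move=> [/andP[/= ph /andP[_ pt]] [/(_ isT) l_le gaps]]; split=> //.
  split; first by rewrite /is_partition (path_sorted ph).
  split; first by move=> t_gt0; apply: (gaps 0%N).
  by move=> i lti; apply: (gaps i.+1).
move=> [l_le_h [/andP[st pt] [hd gaps]]]; split.
  rewrite /is_partition /= pt (leq_trans l_gt0 l_le_h) !andbT.
  case: t st hd {pt gaps} => //= x t -> /(_ isT) hx.
  by rewrite (leq_trans (leq_addr k h) hx).
split=> // -[|i] lti; [exact: hd | exact: gaps].
Qed.

Lemma mem_gap_seqs a l b s : (0 < l)%N ->
  s \in gap_seqs a l b <-> [/\ UG k l s, size s = a & sumn s = b].
Proof.
elim: a l b s => [|a IHa] l b s l_gt0 /=.
  split; last first.
    by case=> _ /size0nil -> /= <-.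
  by case: b => //=; rewrite inE => /eqP ->.
have pos h : (l <= h)%N -> (0 < h + k)%N.
  by move=> lh; rewrite (leq_trans l_gt0) // (leq_trans lh) // leq_addr.
split.
  case/allpairsPdep => h [t [hin tin ->]].
  move: hin; rewrite mem_iota => /andP[lh hb].
  have {}hb : (h <= b)%N by lia.
  have [ugt <- sumt] := (IHa _ _ _ (pos h lh)).1 tin.
  split=> //; first exact/UG_cons.
  by rewrite /= sumt subnKC.
case: s => [|h t] [] // /(UG_cons _ _ l_gt0)[lh ugt] [sizet] /= sumt.
apply/allpairsPdep; exists h, t; split=> //.
  by rewrite mem_iota lh /=; lia.
by apply/(IHa _ _ _ (pos h lh)); split=> //; lia.
Qed.

Lemma uniq_gap_seqs a l b : uniq (gap_seqs a l b).
Proof.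
elim: a l b => [|a IHa] l b /=; first by case: (b == 0%N).
apply: allpairs_uniq_dep => //; first exact: iota_uniq.
by move=> [h1 t1] [h2 t2] _ _ /= [-> ->].
Qed.

(** The first entry h = l of the [iota] gives the first summand; the remaining entries form the
    range for [l.+1]. *)
Lemma size_gap_seqsS a l b : size (gap_seqs a.+1 l b) =
  if (b < l)%N then 0%N
  else (size (gap_seqs a (l + k) (b - l)) + size (gap_seqs a.+1 l.+1 b))%N.
Proof.
rewrite /=; case: ltnP => [b_lt_l | l_le_b].
  by move/eqP: b_lt_l => ->.
by rewrite subSn //= subSS size_cat size_map.
Qed.

Definition gap_gf a l : fps int :=
  Fps (fun b => (size (gap_seqs a l b))%:R).

Let q := fps_var int.

Lemma gap_gfS a l :
  gap_gf a.+1 l = q ^+ l * gap_gf a (l + k) + gap_gf a.+1 l.+1.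
Proof.
apply: fpsP => b.
have -> : fcoef (q ^+ l * gap_gf a (l + k) + gap_gf a.+1 l.+1) b =
  fcoef (q ^+ l * gap_gf a (l + k)) b + fcoef (gap_gf a.+1 l.+1) b by [].
rewrite fcoef_varXM /gap_gf ![fcoef (Fps _) _]/= -!/(gap_seqs _.+1 _ _).
rewrite [in LHS]size_gap_seqsS; case: ltnP => [b_lt_l|_]; last by rewrite natrD.
by rewrite size_gap_seqsS ifT ?addr0 //; lia.
Qed.

(** For each b, shifting b + 1 times moves the index beyond b without changing the series, so its
    coefficient at b vanishes. *)
Lemma fps_eq0_of_shift (D : nat -> fps int) l :
  (forall i, D i = D i.+1) -> (forall i b, (b < i)%N -> fcoef (D i) b = 0) ->
  D l = 0.
Proof.
move=> shift low; apply: fpsP => b.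
have -> : D l = D (b.+1 + l)%N by elim: b.+1 => // n ->; rewrite shift.
by rewrite low /= ?if_same // leq_addr.
Qed.

Lemma gap_gf_qpoch a l : gap_gf a l * qpoch q q a = q ^+ (a * l + k * 'C(a, 2)).
Proof.
elim: a l => [|a IHa] l.
  rewrite /qpoch big_ord0 mulr1 muln0 expr0; apply: fpsP => b /=.
  by case: b.
apply/eqP; rewrite -subr_eq0; apply/eqP.
(* With E = (a+1)i + k C(a+1,2), the closed form obeys the recurrence because q^E (1 - q^(a+1)) +
   q^(E+a+1) = q^E; the inhomogeneous terms cancel by induction. *)
pose D i := gap_gf a.+1 i * qpoch q q a.+1 - q ^+ (a.+1 * i + k * 'C(a.+1, 2)).
apply: (@fps_eq0_of_shift D) => [i|i b b_lt_i].
  rewrite /D gap_gfS !qpochS -exprS.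
  move: (gap_gf a _) (gap_gf a.+1 _) (qpoch q q a) (IHa (i + k)%N)
    => P P' u IHu.
  have -> : (q ^+ i * P + P') * (u * (1 - q ^+ a.+1))
            = q ^+ i * (P * u) * (1 - q ^+ a.+1) + P' * (u * (1 - q ^+ a.+1)).
    ring.
  rewrite IHu -exprD.
  have -> : (i + (a * (i + k) + k * 'C(a, 2)) = a.+1 * i + k * 'C(a.+1, 2))%N.
    by rewrite binS bin1; ring.
  have -> : (a.+1 * i.+1 + k * 'C(a.+1, 2)
             = a.+1 * i + k * 'C(a.+1, 2) + a.+1)%N.
    ring.
  rewrite (exprD _ _ a.+1); ring.
(* Both terms of D i are divisible by q^i: the smallest part is at least i, and (a+1)i >= i. The
   factor 1 only gives the monomial the shape of [fcoef_varXM]. *)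
have -> : fcoef (D i) b = fcoef (gap_gf a.+1 i * qpoch q q a.+1) b -
  fcoef (q ^+ (a.+1 * i + k * 'C(a.+1, 2)) * 1) b by rewrite mulr1.
rewrite fcoef_varXM ifT; last first.
  by rewrite (leq_trans b_lt_i) // mulSn -addnA leq_addr.
rewrite subr0 fcoefM big1 // => j _.
have -> : fcoef (gap_gf a.+1 i) j = (size (gap_seqs a.+1 i j))%:R by [].
by rewrite size_gap_seqsS (leq_trans (ltn_ord j) b_lt_i) mul0r.
Qed.
End Enumeration.

(** * The exponent Q as a natural number *)

Lemma bin2D m n : 'C(m + n, 2) = ('C(m, 2) + 'C(n, 2) + m * n)%N.
Proof.
elim: m => [|m IHm]; first by rewrite bin0n mul0n addn0.
by rewrite addSn !binS !bin1 IHm; ring.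
Qed.

Definition Qnat (k l m n : nat) : nat :=
  ((m + n) * l + k * 'C(m + n, 2) + 'C(m.+1, 2))%N.

(** The multiples of k collect to C(n,2) + mn - m + C(m+1,2) = C(m+n,2), which absorbs the negative
    term at n = 0. *)
Lemma QexpE k l m n : Qexp k l m n = (Qnat k l m n)%:Z.
Proof.
have half_up (i : nat) : ((i%:Z * (i%:Z + 1)) %/ 2)%Z = 'C(i.+1, 2)%:Z.
  by rewrite bin2 -PoszD -PoszM addn1 mulnC -divn2 divz_nat.
have half_down (i : nat) : ((i%:Z * (i%:Z - 1)) %/ 2)%Z = 'C(i, 2)%:Z.
  case: i => [|i]; first by rewrite mul0r div0z.
  by rewrite -addn1 PoszD addrK mulrC half_up addn1.
rewrite /Qexp /Qnat half_up half_down bin2D binS bin1.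
rewrite !(PoszD, PoszM); ring.
Qed.

(** * Coefficients of the summands *)

Section Coefficients.
Variables k l : nat.
Let q := fps_var int.

Lemma qvarX n : qvar ^+ n = fps_const (q ^+ n).
Proof. by rewrite rmorphXn. Qed.

Lemma series_coef_monomial N u a b :
  series_coef (xvar ^+ N * fps_const u) a b = if a == N then fcoef u b else 0.
Proof.
rewrite /series_coef fcoef_varXM /=; case: ltngtP => [_|N_lt_a|->].
- by rewrite /= if_same.
- by rewrite subn_eq0 leqNgt N_lt_a /= if_same.
- by rewrite subnn.
Qed.

Lemma unit_one_sub_qX i : (0 < i)%N -> 1 - q ^+ i \is a GRing.unit.
Proof. exact: unit_one_sub_varX. Qed.

Definition double_term (m n : nat) : fps int :=
  q ^+ Qnat k l m n / (qpoch q q m * qpoch (q ^+ 2) (q ^+ 2) n./2).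

(** The denominators are already units of Z[[q]], so the embedding of constants in x carries their
    inverses along; each summand is a monomial in x. *)
Lemma double_termE m n :
  xvar ^+ (m + n) * qvar ^ Qexp k l m n
      / (qpoch qvar qvar m * qpoch (qvar ^+ 2) (qvar ^+ 2) n./2)
  = xvar ^+ (m + n) * fps_const (double_term m n).
Proof.
rewrite QexpE -exprnP -mulrA; congr (_ * _).
rewrite /double_term rmorphM rmorphV; last first.
  rewrite unitrM unit_qpoch ?unit_qpoch_sq //; exact: unit_one_sub_qX.
by rewrite rmorphM !rmorph_qpoch !rmorphXn.
Qed.

(** The indices 2n and 2n+1 have the same half, hence the same denominator, and Q(m,2n+1) - Q(m,2n)
    = l + (m+2n)k. *)
Lemma double_term_pairE m n :
  xvar ^+ (m + 2 * n) * qvar ^ Qexp k l m (2 * n)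
      * (1 + xvar * qvar ^+ (l + (m + 2 * n) * k))
      / (qpoch qvar qvar m * qpoch (qvar ^+ 2) (qvar ^+ 2) n)
  = xvar ^+ (m + 2 * n) * fps_const (double_term m (2 * n))
    + xvar ^+ (m + (2 * n).+1) * fps_const (double_term m (2 * n).+1).
Proof.
rewrite -!double_termE mul2n -[n.*2.+1./2]/(uphalf n.*2) uphalf_double doubleK.
have -> : Qexp k l m n.*2.+1 = Qexp k l m n.*2 + (l + (m + n.*2) * k)%N.
  rewrite !QexpE -PoszD; congr Posz.
  by rewrite /Qnat addnS binS bin1; ring.
rewrite !QexpE -PoszD -!exprnP (exprD qvar (Qnat _ _ _ _)) addnS (exprS xvar).
set D := (_ * _)^-1; ring.
Qed.

Lemma sum_double_term N :
  \sum_(m < N.+1) double_term m (N - m)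
  = q ^+ (N * l + k * 'C(N, 2)) / qpoch q q N.
Proof.
rewrite -(sum_qpoch_half unit_one_sub_qX) mulr_sumr; apply: eq_bigr => m _.
by rewrite /double_term /Qnat subnKC -1?ltnS // exprD mulrA.
Qed.

Lemma gap_gfE a : gap_gf k a l = q ^+ (a * l + k * 'C(a, 2)) / qpoch q q a.
Proof.
by rewrite -gap_gf_qpoch mulrK // unit_qpoch //; apply: unit_one_sub_qX.
Qed.

Lemma series_coef_parts s a b :
  series_coef (xvar ^+ size s * qvar ^+ sumn s) a b
  = ((size s == a) && (sumn s == b))%:R.
Proof.
rewrite qvarX series_coef_monomial eq_sym; case: eqP => //= _.
rewrite -[q ^+ _]mulr1 fcoef_varXM; case: ltngtP => //= [lt_s_b|->].
  by rewrite subn_eq0 leqNgt lt_s_b.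
by rewrite subnn.
Qed.

End Coefficients.

(** * Finitely supported sums over boxes and antidiagonals *)

Section Boxes.
Variables (M N : nat).

Let box := [seq (m, n) | m <- index_iota 0 M, n <- index_iota 0 N].

Let mem_box p : (p \in box) = (p.1 < M)%N && (p.2 < N)%N.
Proof.
apply/allpairsP/idP => [[[m n] /= [mM nN ->]]|/andP[mM nN]].
  by move: mM nN; rewrite !mem_index_iota /= => -> ->.
by exists p; rewrite !mem_index_iota mM nN; case: p {mM nN}.
Qed.

Lemma finite_support_box (P : set (nat * nat)) :
  (forall m n, P (m, n) -> (m < M)%N && (n < N)%N) -> finite_set P.
Proof.
move=> PMN; apply: (sub_finite_set _ (finite_seq box)) => -[m n] /PMN mn /=.
by rewrite mem_box.
Qed.

Lemma fsbig_box (V : nmodType) (f : nat * nat -> V) :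
  (forall m n, f (m, n) != 0 -> (m < M)%N && (n < N)%N) ->
  \sum_(p \in [set: nat * nat]) f p
  = \sum_(m < M) \sum_(n < N) f (m : nat, n : nat).
Proof.
move=> fMN; rewrite (@fsbigE _ _ _ _ _ box) //; last first.
- move=> [m n] _; rewrite mem_box => mn; apply/eqP.
  by apply: contraNT mn => /fMN.
- by apply: allpairs_uniq; rewrite ?iota_uniq // => -[? ?] [? ?].
under eq_bigl do rewrite in_setT.
rewrite big_allpairs big_mkord; apply: eq_bigr => m _.
by rewrite big_mkord.
Qed.

End Boxes.

Lemma sum_even_odd (V : nmodType) (f : nat -> V) N :
  \sum_(n < 2 * N) f n = \sum_(n < N) (f (2 * n)%N + f (2 * n).+1).
Proof.
elim: N => [|N IHN]; first by rewrite muln0 !big_ord0.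
by rewrite mulnS !big_ord_recr /= IHN addrA.
Qed.

Lemma sum_antidiagonal (V : nmodType) (f : nat -> nat -> V) a N : (a < N)%N ->
  \sum_(m < a.+1) \sum_(n < N) (if a == (m + n)%N then f m n else 0)
  = \sum_(m < a.+1) f m (a - m)%N.
Proof.
move=> a_lt_N; apply: eq_bigr => m _; have m_le_a : (m <= a)%N by rewrite -ltnS.
have lt_N : (a - m < N)%N by rewrite (leq_ltn_trans (leq_subr _ _)).
rewrite (bigD1 (Ordinal lt_N)) //= subnKC // eqxx big1 ?addr0 // => n.
rewrite -val_eqE /= => /eqP n_neq; case: eqP => // a_eq.
by case: n_neq; lia.
Qed.

(** * Coefficientwise comparison of the three sums *)

Theorem theorem2p3 (k l : nat) (hl : (0 < l)%N) :
  let x := xvar in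
  let q := qvar in
  let F1 (s : seq nat) := x ^+ size s * q ^+ sumn s in
  let F2 (p : nat * nat) :=
    let: (m, n) := p in
    x ^+ (m + n) * q ^ Qexp k l m n
      / (qpoch q q m * qpoch (q ^+ 2) (q ^+ 2) n./2) in
  let F3 (p : nat * nat) :=
    let: (m, n) := p in
    x ^+ (m + 2 * n) * q ^ Qexp k l m (2 * n)
      * (1 + x * q ^+ (l + (m + 2 * n) * k))
      / (qpoch q q m * qpoch (q ^+ 2) (q ^+ 2) n) in
  [/\ summable (UG k l) F1, summable setT F2 & summable setT F3] /\
  formal_sum (UG k l) F1 = formal_sum setT F2 /\
  formal_sum setT F2 = formal_sum setT F3.
Proof.
move=> x q F1 F2 F3.
have F1_coef s a b :
    series_coef (F1 s) a b = ((size s == a) && (sumn s == b))%:R.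
  exact: series_coef_parts.
pose t (a b m n : nat) : int :=
     if a == (m + n)%N then fcoef (double_term k l m n) b else 0.
have F2_coef m n a b : series_coef (F2 (m, n)) a b = t a b m n.
  by rewrite /F2 double_termE series_coef_monomial.
have F3_coef m n a b :
    series_coef (F3 (m, n)) a b = t a b m (2 * n)%N + t a b m (2 * n).+1.
  rewrite /F3 double_term_pairE.
  by rewrite /t -!series_coef_monomial.
(* With their bodies visible, rewriting tries to unify F2 with F3 and diverges. *)
clearbody F1 F2 F3.
have F1_out s a b : UG k l s -> s \notin gap_seqs k a l b ->
    series_coef (F1 s) a b = 0.
  move=> ugs s_out; rewrite F1_coef; case: andP => // -[/eqP sa /eqP sb].
  by case/negP: s_out; apply/mem_gap_seqs.
have t_supp a b m n : t a b m n != 0 -> (m < a.+1)%N && (n < a.+1)%N.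
  rewrite /t; have [-> _|_] := eqVneq a (m + n)%N; last by rewrite eqxx.
  by rewrite !ltnS leq_addr leq_addl.
have F2_supp a b m n :
    series_coef (F2 (m, n)) a b != 0 -> (m < a.+1)%N && (n < a.+1)%N.
  by rewrite F2_coef; apply: t_supp.
have F3_supp a b m n :
    series_coef (F3 (m, n)) a b != 0 -> (m < a.+1)%N && (n < a.+1)%N.
  rewrite F3_coef; apply: contraNT => out.
  (* Outside the box, t vanishes at every n' >= n, in particular at 2n and 2n+1. *)
  have t0 n' : (n <= n')%N -> t a b m n' = 0.
    move=> n_le; apply/eqP; apply: contraNT out => /t_supp/andP[-> n'_lt].
    by rewrite (leq_ltn_trans n_le).
  by rewrite !t0 ?addr0 //; lia.
have F1_sum a b :
    \sum_(s \in UG k l) series_coef (F1 s) a b = fcoef (gap_gf k a l) b.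
  rewrite (@fsbigE _ _ _ _ _ (gap_seqs k a l b)); last first.
  - by move=> s; apply: F1_out.
  - by move=> s /= /(mem_gap_seqs _ _ _ _ hl)[].
  - exact: uniq_gap_seqs.
  rewrite -[RHS]/((size (gap_seqs k a l b))%:R) -sum1_size natr_sum.
  (* Each listed partition contributes exactly 1. *)
  rewrite big_seq_cond [RHS]big_seq_cond; apply: eq_big => [s|s /andP[]].
    rewrite andbT; case: (boolP (s \in gap_seqs k a l b)) => //= s_in.
    by apply/mem_set; case/(mem_gap_seqs _ _ _ _ hl): s_in.
  by case/(mem_gap_seqs _ _ _ _ hl) => _ <- <- _; rewrite F1_coef !eqxx.
have F2_sum a b :
    \sum_(p \in setT) series_coef (F2 p) a b = fcoef (gap_gf k a l) b.
  rewrite (fsbig_box (F2_supp a b)) gap_gfE -sum_double_term fcoef_sum.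
  rewrite -(sum_antidiagonal (fun m n => fcoef (double_term k l m n) b)
             (ltnSn a)).
  by apply: eq_bigr => m _; apply: eq_bigr => n _; apply: F2_coef.
have F3_sum a b : \sum_(p \in setT) series_coef (F2 p) a b
    = \sum_(p \in setT) series_coef (F3 p) a b.
  (* The box for F2 is doubled in n so that its columns 2n and 2n+1 pair up with the a+1 columns of
     F3. *)
  rewrite [RHS](fsbig_box (F3_supp a b)) [LHS](@fsbig_box a.+1 (2 * a.+1)).
    apply: eq_bigr => m _.
    rewrite (sum_even_odd (fun n => series_coef (F2 (m : nat, n)) a b)).
    by apply: eq_bigr => n _; rewrite F3_coef !F2_coef.
  move=> m n /F2_supp/andP[-> n_lt].
  by rewrite (leq_trans n_lt) // leq_pmull.
split; [split|split].
- move=> a b; apply: (sub_finite_set _ (finite_seq (gap_seqs k a l b))).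
  by move=> s [ugs] /=; apply: contraNT => /(F1_out _ _ _ ugs) ->.
- move=> a b; apply: (@finite_support_box a.+1 a.+1) => m n [_].
  exact: F2_supp.
- move=> a b; apply: (@finite_support_box a.+1 a.+1) => m n [_].
  exact: F3_supp.
- by congr Fps; apply/funext => a; congr Fps; apply/funext => b;
    rewrite F1_sum F2_sum.
- by congr Fps; apply/funext => a; congr Fps; apply/funext => b;
    rewrite F3_sum.
Qed.
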